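(* Let $\mathbb R^{m+1}=\mathbb R\times\mathbb R^m$ ($m\ge2$) be Euclidean space with coordinates $(s,x)$, and let $\Sigma=\{(v(x),x):x\in\mathbb R^m\}$ be an entire graph. Assume that $$\limsup_{r(x)\to\infty}\frac{|v(x)|}{r(x)}=\hat v<\infty.$$ Then $\Sigma$ cannot be a self-translator with respect to any vector $Y$ whose angle $\vartheta\in(0,\pi/2)$ with the horizontal hyperplane $\mathbb R^m$ satisfies $$\tan\vartheta>\hat v.$$ In particular, if $\hat v=0$, $\Sigma$ cannot be a self-translator with respect to a vector $Y$ which is not tangent to the horizontal $\mathbb R^m$.
   Context: $r(x)=|x|$ is the distance from the origin in $\mathbb R^m$; the horizontal hyperplane is $\{s=0\}=\mathbb R^m$. The graph function $v:\mathbb R^m\to\mathbb R$ is $C^2$. Given a constant vector $Y\in\mathbb R^{m+1}$, $Y\ne0$, the hypersurface $\Sigma$ is a self-translator (for the mean curvature flow) with respect to $Y$ if $\overrightarrow H=Y^\perp$ along $\Sigma$, where $\overrightarrow H$ is the unnormalized mean curvature vector (trace of the second fundamental form) and $\perp$ is the orthogonal projection on the normal bundle of $\Sigma$. *)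

(* Defs.v *)
From HB Require Import structures.
From mathcomp Require Import all_boot all_order all_algebra.
From mathcomp Require Import all_classical all_reals all_analysis.

Set Implicit Arguments.
Unset Strict Implicit.
Unset Printing Implicit Defensive.

Import Order.TTheory GRing.Theory Num.Theory.
Import numFieldNormedType.Exports.

Local Open Scope classical_set_scope.
Local Open Scope ring_scope.

Section Euclidean.
Context {R : realType} {n : nat}.

Definition dot (u w : 'rV[R]_n) : R := \sum_(i < n) u 0 i * w 0 i.

(* The library norm on ['rV[R]_n] is the sup norm. *)
Definition enorm (u : 'rV[R]_n) : R := Num.sqrt (dot u u).

(* The filter of the limits "as [enorm x] tends to infinity". *)
Definition enorm_infty : set_system 'rV[R]_n :=
  filter_from [set: R] (fun M => [set x | M < enorm x]).

End Euclidean.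

Section Smoothness.
Context {R : realType} {m : nat} {W : normedModType R}.

Definition partial (i : 'I_m) (f : 'rV[R]_m -> W) (x : 'rV[R]_m) : W :=
  'D_(delta_mx 0 i) f x.

Fixpoint Ck (k : nat) (f : 'rV[R]_m -> W) : Prop :=
  continuous f /\
  if k is k'.+1 then
    forall i : 'I_m,
      (forall x, derivable f x (delta_mx 0 i)) /\ Ck k' (partial i f)
  else True.

End Smoothness.

(* Extrinsic geometry of a hypersurface (more generally, a submanifold) of R^n
   given by a global C^2 parametrization [F : R^m -> R^n] that is an
   immersion, so that the Gram matrix below is invertible. *)
Section Immersion.
Context {R : realType} {m n : nat}.
Variable F : 'rV[R]_m -> 'rV[R]_n.

Definition metric (x : 'rV[R]_m) : 'M[R]_m :=
  \matrix_(i < m, j < m) dot (partial i F x) (partial j F x).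

Definition inv_metric (x : 'rV[R]_m) : 'M[R]_m := invmx (metric x).

Definition tangent_part (x : 'rV[R]_m) (u : 'rV[R]_n) : 'rV[R]_n :=
  \sum_(i < m) \sum_(j < m)
    (inv_metric x i j * dot u (partial i F x)) *: partial j F x.

Definition normal_part (x : 'rV[R]_m) (u : 'rV[R]_n) : 'rV[R]_n :=
  u - tangent_part x u.

Definition second_fundamental_form (x : 'rV[R]_m) (i j : 'I_m) : 'rV[R]_n :=
  normal_part x (partial i (partial j F) x).

(* Unnormalized: the trace of the second fundamental form, not divided by m. *)
Definition mean_curvature_vector (x : 'rV[R]_m) : 'rV[R]_n :=
  \sum_(i < m) \sum_(j < m) inv_metric x i j *: second_fundamental_form x i j.

Definition self_translator (Y : 'rV[R]_n) : Prop :=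
  forall x : 'rV[R]_m, mean_curvature_vector x = normal_part x Y.

End Immersion.

(* A point [(s, x)] of R x R^m is [row_mx s%:M x : 'rV[R]_(1 + m)]. *)
Section Graphs.
Context {R : realType} {m : nat}.

Definition graph_param (v : 'rV[R]_m -> R) (x : 'rV[R]_m) : 'rV[R]_(1 + m) :=
  row_mx (v x)%:M x.

Definition s_coord (Y : 'rV[R]_(1 + m)) : R := lsubmx Y 0 0.

Definition horizontal (Y : 'rV[R]_(1 + m)) : Prop := s_coord Y = 0.

(* The (unoriented) angle in [0, pi/2] of a nonzero vector with {s = 0},
   i.e. the complement of its angle with the vertical line. *)
Definition angle_horizontal (Y : 'rV[R]_(1 + m)) : R :=
  asin (`|s_coord Y| / enorm Y).

End Graphs.

(* Main.v *)
Require Import Defs.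
From HB Require Import structures.
From mathcomp Require Import all_boot all_order all_algebra.
From mathcomp Require Import all_classical all_reals all_analysis.
From mathcomp Require Import ring lra.

Import Order.TTheory GRing.Theory Num.Theory.
Import numFieldNormedType.Exports.

Local Open Scope classical_set_scope.
Local Open Scope ring_scope.

(** Write [Y = (s, y)] and [p] for the gradient of [v].  Pairing the translator
    equation with the (unnormalized) normal [(1, - p)] of the graph turns it
    into the elliptic equation
      [sum_ij g^ij v_ij = s - <p, y>],   with [g = 1 + p^T p]
    ([translator_equation]).  Since [g] is even in [p], replacing [v] by [- v]
    and [s] by [- s] preserves the equation, so one may assume [0 < s].

    The condition on the angle says that [vhat * |y| < |s|], because the tangent
    of the angle is [|s| / |y|]; for [vhat = 0] it only says that [s] is not
    zero, and vertical vectors are then covered as well.  So there is a slope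
    [a > vhat] with [a * |y| < s].  The function [v - a * sqrt (r^2 + |x|^2)]
    tends to minus infinity and has a maximum point [x0].  The cone-like barrier
    has slope at most [a] and Hessian at most [a / r], so at [x0] the gradient
    of [v] has norm at most [a] while the left-hand side of the equation is at
    most [m * a / r].  The right-hand side is at least [s - a * |y| > 0], and a
    large [r] gives a contradiction ([no_solution_of_small_slope]).

    Two devices keep the calculus short.  By concavity of the square root, the
    barrier lies below a paraboloid [k * |x|^2 + const] touching it at [x0], so
    the paraboloid itself touches [v] from above
    ([paraboloid_touching]) and only a quadratic polynomial is ever compared
    with [v].  The comparison is then made along each line through [x0], where
    it is a statement about functions of one variable ([touching_parabola]); the
    continuity of the partial derivatives expresses the derivatives along the
    line through the gradient and the Hessian ([is_derive_partials]). *)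

(** * The Euclidean inner product *)

Section DotProduct.
Context {R : realType}.

Fact dot_is_scalar n (u : 'rV[R]_n) : scalar (dot u).
Proof.
move=> k a b; rewrite /dot mulr_sumr -big_split; apply: eq_bigr => i _.
by rewrite !mxE mulrDr mulrCA.
Qed.

HB.instance Definition _ n (u : 'rV[R]_n) :=
  GRing.isLinear.Build R 'rV[R]_n R *%R (dot u) (@dot_is_scalar n u).

Lemma dotE n (u w : 'rV[R]_n) : dot u w = (u *m w^T) 0 0.
Proof. by rewrite mxE; apply: eq_bigr => i _; rewrite mxE. Qed.

Lemma dotC n (u w : 'rV[R]_n) : dot u w = dot w u.
Proof. by apply: eq_bigr => i _; rewrite mulrC. Qed.

Lemma dot_ge0 n (u : 'rV[R]_n) : 0 <= dot u u.
Proof. by apply: sumr_ge0 => i _; rewrite -expr2 sqr_ge0. Qed.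

Lemma dot_line n (x b : 'rV[R]_n) (t : R) :
  dot (x + t *: b) (x + t *: b) = dot x x + 2 * dot x b * t + dot b b * t ^+ 2.
Proof.
rewrite linearD linearZ /= ![dot (x + _) _]dotC !linearD !linearZ /=.
rewrite [dot b x]dotC; ring.
Qed.

Lemma dot_row_mx n1 n2 (a c : 'rV[R]_n1) (b d : 'rV[R]_n2) :
  dot (row_mx a b) (row_mx c d) = dot a c + dot b d.
Proof. by rewrite !dotE tr_row_mx mul_row_col mxE. Qed.

Lemma dot_scalar (a b : R) : dot (a%:M : 'rV_1) b%:M = a * b.
Proof. by rewrite /dot big_ord1 !mxE !mulr1n. Qed.

Lemma dot_delta n (u : 'rV[R]_n) i : dot u (delta_mx 0 i) = u 0 i.
Proof.
rewrite /dot (bigD1 i) //= big1 ?addr0 => [|j ji]; first by rewrite mxE !eqxx mulr1.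
by rewrite mxE (negPf ji) andbF mulr0.
Qed.

Lemma enorm_ge0 n (u : 'rV[R]_n) : 0 <= enorm u.
Proof. exact: sqrtr_ge0. Qed.

Lemma sqr_enorm n (u : 'rV[R]_n) : enorm u ^+ 2 = dot u u.
Proof. by rewrite sqr_sqrtr ?dot_ge0. Qed.

Lemma le_coord_enorm n (u : 'rV[R]_n) i : `|u 0 i| <= enorm u.
Proof.
rewrite -sqrtr_sqr ler_wsqrtr // /dot (bigD1 i) //= -expr2 lerDl.
by apply: sumr_ge0 => j _; rewrite -expr2 sqr_ge0.
Qed.

(** Cauchy-Schwarz, from the squared norm of [|w| u - |u| w], which equals
    [2 |u| |w| (|u| |w| - <u, w>)]; a zero norm is treated apart because one
    divides by [|u| |w|]. *)
Lemma dot_le_enorm n (u w : 'rV[R]_n) : dot u w <= enorm u * enorm w.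
Proof.
have deg n' (a b : 'rV[R]_n') : enorm a = 0 -> dot a b = 0.
  move=> a0; apply: big1 => i _; have := le_coord_enorm _ a i.
  by rewrite a0 normr_le0 => /eqP ->; rewrite mul0r.
have [u0|u0] := eqVneq (enorm u) 0; first by rewrite deg // u0 mul0r.
have [w0|w0] := eqVneq (enorm w) 0; first by rewrite dotC deg // w0 mulr0.
have p0 : 0 < enorm u * enorm w by rewrite mulr_gt0 // lt_def enorm_ge0 ?u0 ?w0.
rewrite -(ler_pM2l p0).
have := dot_ge0 _ (enorm w *: u + - enorm u *: w).
rewrite dot_line linearZ /= ![dot (_ *: u) _]dotC !linearZ /= -!sqr_enorm.
rewrite [dot w u]dotC.
nra.
Qed.

End DotProduct.

(** * Directional derivatives of C^1 functions *)

Lemma is_derive_line (R : realType) (V : normedModType R) (f : V -> R)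
    (x b : V) (t d : R) :
  is_derive (x + t *: b) b f d -> is_derive t 1 (fun s => f (x + s *: b)) d.
Proof.
have quotE : (fun h : R => h^-1 *: (((fun s : R => f (x + s *: b)) \o shift t)
      (h *: 1) - f (x + t *: b)))
    = (fun h => h^-1 *: ((f \o shift (x + t *: b)) (h *: b) - f (x + t *: b))).
  apply/funext => h /=; congr (_ *: (f _ - _)).
  by rewrite [h *: 1]mulr1 scalerDl addrCA.
by case=> df <-; apply: DeriveDef; rewrite /derivable/derive quotE.
Qed.

Lemma derivable_line_continuous (R : realType) (g g' : R -> R) :
  (forall t : R, is_derive t 1 g (g' t)) -> continuous g.
Proof.
move=> dg t; apply: differentiable_continuous.
by apply/derivable1_diffP; case: (dg t).
Qed.

(** The mean value theorem rewrites the increment of [f] from [x + h w] to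
    [x + h w + h k u] as [h k] times a value of [du] at a point that tends to
    [x] with [h]; continuity of [du] at [x] does the rest.  This produces
    derivatives in all directions from the partial ones, one coordinate at a
    time. *)
Lemma is_derive_add_direction (R : realType) (V : normedModType R)
    (f : V -> R) (x u w : V) (k : R) (du : V -> R) (dw : R) :
  (forall y, is_derive y u f (du y)) -> du @ x --> du x ->
  is_derive x w f dw -> is_derive x (k *: u + w) f (k * du x + dw).
Proof.
move=> fu duc [fw fwE].
have mvt (y : V) (a : R) : exists c : R,
    `|c| <= `|a| /\ f (y + a *: u) - f y = a * du (y + c *: u).
  pose g (s : R) := f (y + s *: u).
  have dg (s : R) : is_derive s 1 g (du (y + s *: u)) by exact: is_derive_line.
  have gc A : {within A, continuous g}.
    exact/continuous_subspaceT/(derivable_line_continuous _ g _ dg).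
  have [a0|a0] := leP 0 a.
    have [c] := @MVT_segment R g _ 0 a a0 (fun s _ => dg s) (gc _).
    rewrite in_itv /= => /andP[c0 ca].
    rewrite /g scale0r addr0 subr0 mulrC => ->; exists c; split => //.
    by rewrite !ger0_norm.
  have [c] := @MVT_segment R g _ a 0 (ltW a0) (fun s _ => dg s) (gc _).
  rewrite in_itv /= => /andP[ca c0].
  rewrite /g scale0r addr0 sub0r => E; exists c; split.
    by rewrite !ler0_norm ?lerN2 // ltW.
  by rewrite -opprB E mulrN opprK mulrC.
have [c cP] := choice (fun h : R => mvt (h *: w + x) (h * k)).
have h0 : h @[h --> (0:R)^'] --> (0 : R) by exact: nbhs_dnbhs.
have c0 : c h @[h --> 0^'] --> (0 : R).
  apply/norm_cvg0P; apply: (squeeze_cvgr (f := cst 0) (h := fun h => `|h * k|)).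
  - by near=> h; rewrite normr_ge0 /=; case: (cP h).
  - exact: cvg_cst.
  - have : `|h * k| @[h --> 0^'] --> `|0 * k|.
      by apply: cvg_norm; apply: cvgM; [exact: h0|exact: cvg_cst].
    by rewrite mul0r normr0.
have lim : h^-1 *: ((f \o shift x) (h *: (k *: u + w)) - f x) @[h --> 0^'] -->
    k * du x + dw.
  rewrite -fwE.
  have : k * du (h *: w + x + c h *: u) +
      h^-1 *: ((f \o shift x) (h *: w) - f x) @[h --> 0^'] --> k * du x + 'D_w f x.
    apply: cvgD; last exact: fw.
    apply: cvgM; first exact: cvg_cst.
    apply: (cvg_comp _ _ _ duc).
    have : h *: w + x + c h *: u @[h --> 0^'] --> 0 *: w + x + 0 *: u.
      apply: cvgD; last exact: cvgZr_tmp.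
      by apply: cvgD; [exact: cvgZr_tmp|exact: cvg_cst].
    by rewrite !scale0r addr0 add0r.
  apply: cvg_trans; apply: near_eq_cvg; near=> h.
  have hn0 : h != 0 by near: h; exact: nbhs_dnbhs_neq.
  have [_ E] := cP h; rewrite /= .
  rewrite [in RHS](_ : h *: (k *: u + w) + x =
    h *: w + x + (h * k) *: u); last first.
    by rewrite [in LHS]scalerDr scalerA -addrA addrC.
  rewrite -[f (_ + _ + (h * k) *: u)](subrK (f (h *: w + x))) E.
  rewrite -[_ + f _ - f x]addrA [RHS]scalerDr -mulrA; congr (_ + _).
  by rewrite [RHS]mulKf.
by apply: DeriveDef; [apply/cvg_ex; exists (k * du x + dw)|exact: cvg_lim lim].
Unshelve. all: by end_near. Qed.

(** Coordinate directions are added one by one, so that only the sum already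
    formed needs a derivative at the single point [x]. *)
Lemma is_derive_partials (R : realType) (m : nat) (f : 'rV[R]_m -> R)
    (p : 'I_m -> 'rV[R]_m -> R) (x b : 'rV[R]_m) :
  (forall i y, is_derive y (delta_mx 0 i) f (p i y)) ->
  (forall i, {for x, continuous (p i)}) ->
  is_derive x b f (\sum_(i < m) b 0 i * p i x).
Proof.
move=> fp pc; rewrite [b in is_derive _ b]row_sum_delta.
elim: (index_enum _) => [|i r IH]; first by rewrite !big_nil; exact: is_derive0.
by rewrite !big_cons; apply: is_derive_add_direction => //; exact: pc.
Qed.

(** * Contact with paraboloids *)

(** The difference [h] of the two functions has a maximum at [0], so [h' 0 = 0];
    a positive second derivative there would make [h'] positive just to the
    right of [0] and [h] larger than [h 0]. *)
Lemma touching_parabola (R : realType) (g g' : R -> R) (A c K : R) :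
  (forall t : R, is_derive t 1 g (g' t)) -> is_derive (0 : R) 1 g' A ->
  (forall t, g t <= g 0 + c * t + K * t ^+ 2) -> g' 0 = c /\ A <= 2 * K.
Proof.
move=> dg dg' gle.
pose h t := g t - (c * t + K * t ^+ 2).
pose h' t := g' t - (c + 2 * K * t).
have dh (t : R) : is_derive t 1 h (h' t).
  apply: is_deriveB; apply: is_derive_eq.
  by rewrite /GRing.scale /=; ring.
have h_max t : h t <= h 0 by rewrite /h; have := gle t; lra.
have h'0 : h' 0 = 0.
  have [_ D0] : is_derive (0 : R) 1 h 0.
    by apply: (@derive1_at_max R h (-1) 1 0) => //; rewrite in_itv /= ltrN10 ltr01.
  by case: (dh 0) => _ <-.
split; first by move: h'0; rewrite /h' mulr0 addr0 => /subr0_eq.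
have [//|KA] := leP A (2 * K).
have dh' : is_derive (0 : R) 1 h' (A - 2 * K).
  apply: is_deriveB; apply: is_derive_eq.
  by rewrite /GRing.scale /=; ring.
have [dd dE] := dh'.
have : \forall t \near 0^', 0 < t^-1 *: ((h' \o shift 0) (t *: 1) - h' 0).
  apply: (cvgr_gt (A - 2 * K)); last by rewrite subr_gt0.
  by rewrite -dE; exact: dd.
rewrite /= h'0 /=.
move=> /nbhs_ballP[e /= e0 eP].
have h'_gt0 t : 0 < t -> t < e -> 0 < h' t.
  move=> t0 te; have := eP t; rewrite /ball /= sub0r normrN gtr0_norm //.
  move=> /(_ te); rewrite gt_eqF // => /(_ isT).
  by rewrite addr0 subr0 [t *: 1]mulr1 [_ *: _]mulrC pmulr_lgt0 // invr_gt0.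
have hc : {within `[0, e / 2], continuous h}.
  exact/continuous_subspaceT/(derivable_line_continuous _ h _ dh).
have e2 : 0 < e / 2 by rewrite divr_gt0.
have [s] := @MVT R h h' 0 (e / 2) e2 (fun t _ => dh t) hc.
rewrite in_itv /= => /andP[s0 se] E.
have : 0 < h (e / 2) - h 0.
  rewrite E subr0 mulr_gt0 // h'_gt0 // (lt_trans se) //.
  by rewrite ltr_pdivrMr // mulr_natr mulr2n ltrDl.
by rewrite subr_gt0 ltNge h_max.
Qed.

Lemma continuous_dot (R : realType) n : continuous (fun x : 'rV[R]_n => dot x x).
Proof.
apply: continuous_big => [|i _ x]; first exact: add_continuous.
have xi : {for x, continuous (fun y : 'rV[R]_n => y 0 i)} by exact: coord_continuous.
exact: continuousM.
Qed.

(** The point [x0] maximizes [v - a * S] for [S x = sqrt (r^2 + |x|^2)], and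
    [S x <= S x0 + (S x ^ 2 - S x0 ^ 2) / (2 * S x0)] by concavity of the
    square root.  Hence [k = a / (2 * S x0)], which is small when [r] is large
    and gives slope [a * |x0| / S x0 <= a] at [x0]. *)
Lemma paraboloid_touching (R : realType) (m : nat) (v : 'rV[R]_m -> R)
    (a b M eps : R) :
  continuous v -> 0 < a -> b < a -> 0 < eps ->
  (forall x, M < enorm x -> v x <= b * enorm x) ->
  exists x0 k, [/\ 0 <= k, 2 * k <= eps, 2 * k * enorm x0 <= a &
    forall x, v x <= v x0 + k * (dot x x - dot x0 x0)].
Proof.
move=> vc a0 ba eps0 vb.
pose r := a / eps; have r0 : 0 < r by rewrite divr_gt0.
pose S (x : 'rV[R]_m) : R := Num.sqrt (r ^+ 2 + dot x x).
have S2 x : S x ^+ 2 = r ^+ 2 + dot x x.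
  by rewrite sqr_sqrtr // addr_ge0 ?sqr_ge0 ?dot_ge0.
have Sge0 x : 0 <= S x by exact: sqrtr_ge0.
have Sr x : r <= S x.
  by rewrite -ler_sqr ?nnegrE ?(ltW r0) // S2 lerDl dot_ge0.
have Sn x : enorm x <= S x.
  by rewrite -ler_sqr ?nnegrE ?enorm_ge0 // S2 sqr_enorm lerDr sqr_ge0.
have Sgt0 x : 0 < S x by exact: lt_le_trans (Sr x).
pose w x := v x - a * S x.
have wc : continuous w.
  have Sc : continuous S.
    move=> x; apply: (@continuous_comp _ _ _ (fun y => r ^+ 2 + dot y y) Num.sqrt).
      have dc := @continuous_dot R m x.
      by apply: (@continuousD _ _ _ (cst (r ^+ 2))) => //; exact: cst_continuous.
    exact: sqrt_continuous.
  move=> x; apply: (@continuousB _ _ _ v (fun y => a * S y)); first exact: vc.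
  apply: (@continuousM _ _ (cst a)); first exact: cst_continuous.
  exact: Sc.
(* Outside the box of half-width [N], [v - a * S <= - (a - b) * |x|] lies
   below the value at the origin. *)
pose N : R := Num.max 0 (Num.max M ((a * S 0 - v 0) / (a - b))).
have far x : N < enorm x -> w x <= w 0.
  rewrite /N !gt_max => /and3P[_ Mx]; rewrite ltr_pdivrMr ?subr_gt0 // => h.
  rewrite /w; have := vb _ Mx; have := Sn x.
  rewrite -(ler_pM2l a0); lra.
pose K := [set x : 'rV[R]_m | forall i, `[- N, N]%classic (x ord0 i)].
have N0 : 0 <= N by rewrite le_max lexx.
have K0 : K 0 by move=> i; rewrite /= mxE in_itv /= N0 oppr_le0 N0.
have Kc : compact K.
  exact: (@rV_compact R m (fun=> `[- N, N]%classic) (fun=> @segment_compact R _ _)).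
have [x0 _ x0max] := EVT_max_rV (ex_intro _ 0 K0) Kc
  (continuous_subspaceT wc).
have wmax x : w x <= w x0.
  have [Kx|nKx] := pselect (K x); first by apply: x0max; rewrite inE.
  apply: (@le_trans _ _ (w 0)); last by apply: x0max; rewrite inE.
  apply: far; rewrite ltNge; apply/negP => xN; apply: nKx => i.
  by rewrite /= in_itv /= -ler_norml (le_trans (le_coord_enorm _ _ i)).
exists x0, (a / (2 * S x0)).
have kE : 2 * (a / (2 * S x0)) = a / S x0.
  by field; rewrite gt_eqF.
split.
- by rewrite divr_ge0 ?mulr_ge0 // ltW.
- rewrite kE ler_pdivrMr // -ler_pdivrMl // mulrC; exact: Sr.
- by rewrite kE mulrAC ler_pdivrMr // ler_pM2l.
move=> x; have := wmax x; rewrite /w.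
have -> : dot x x - dot x0 x0 = S x ^+ 2 - S x0 ^+ 2 by rewrite !S2; ring.
move: (S x) (S x0) (Sgt0 x0) => s s0 s0_gt0 le_s.
have -> : a / (2 * s0) * (s ^+ 2 - s0 ^+ 2) =
    a * (s - s0) + a * (s - s0) ^+ 2 / (2 * s0).
  by field; rewrite gt_eqF.
have : 0 <= a * (s - s0) ^+ 2 / (2 * s0).
  apply: divr_ge0; last by rewrite mulr_ge0 ?ler0n ?ltW.
  by apply: mulr_ge0; [exact: ltW|exact: sqr_ge0].
lra.
Qed.

(** On the line through [x0] in direction [b] the paraboloid is the parabola
    [v x0 + 2 k <x0, b> t + k |b|^2 t^2], so the one-variable statement applies;
    coordinate directions give the gradient. *)
Lemma paraboloid_touching_conditions (R : realType) (m : nat)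
    (v : 'rV[R]_m -> R) (p : 'rV[R]_m -> 'rV[R]_m) (A : 'rV[R]_m -> 'M[R]_m)
    (x0 : 'rV[R]_m) (k : R) :
  (forall i x, is_derive x (delta_mx 0 i) v (p x 0 i)) ->
  (forall i j x, is_derive x (delta_mx 0 j) (fun y => p y 0 i) (A x j i)) ->
  (forall i, continuous (fun y => p y 0 i)) ->
  (forall i j, continuous (fun y => A y i j)) ->
  (forall x, v x <= v x0 + k * (dot x x - dot x0 x0)) ->
  p x0 = (2 * k) *: x0 /\
  forall b : 'rV[R]_m,
    \sum_(i < m) \sum_(j < m) b 0 i * b 0 j * A x0 i j <= 2 * k * dot b b.
Proof.
move=> dv dp pc Ac vle.
have line (b : 'rV[R]_m) : dot (p x0) b = 2 * k * dot x0 b /\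
    \sum_(i < m) \sum_(j < m) b 0 i * b 0 j * A x0 i j <= 2 * (k * dot b b).
  pose dv_b (x : 'rV[R]_m) := \sum_(i < m) b 0 i * p x 0 i.
  have dvb x : is_derive x b v (dv_b x).
    apply: (@is_derive_partials _ _ _ (fun i y => p y 0 i)) => // i.
    exact: pc.
  have dvb2 : is_derive x0 b dv_b
      (\sum_(i < m) b 0 i * \sum_(j < m) b 0 j * A x0 j i).
    have -> : dv_b = \sum_(i < m) (b 0 i \*: fun x => p x 0 i).
      by apply/funext => x; rewrite fct_sumE.
    apply: is_derive_sum => i; apply: is_deriveZ.
    apply: (@is_derive_partials _ _ _ (fun j y => A y j i)) => // j.
    exact: Ac.
  have := @touching_parabola _ (fun t => v (x0 + t *: b))
    (fun t => dv_b (x0 + t *: b)) _ (2 * k * dot x0 b) (k * dot b b)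
    (fun t => @is_derive_line _ _ _ _ _ _ _ (dvb _))
    (@is_derive_line _ _ dv_b x0 b 0 _ _).
  rewrite scale0r addr0 => /(_ _ dvb2)[t|<- le2].
    rewrite (le_trans (vle _)) // dot_line; lra.
  split; first by rewrite dotC.
  rewrite exchange_big; apply: le_trans le2; rewrite le_eqVlt; apply/orP; left.
  apply/eqP/eq_bigr => i _; rewrite mulr_sumr; apply: eq_bigr => j _; ring.
split=> [|b]; last by have [_] := line b; rewrite mulrA.
apply/rowP => i; have [+ _] := line (delta_mx 0 i).
by rewrite !dot_delta mxE.
Qed.

(** * The inverse metric of a graph *)

Section Elliptic.
Context {R : realType} {m : nat}.
Implicit Types (A B : 'M[R]_m) (p b : 'rV[R]_m).

(** The first fundamental form of a graph whose gradient is [p]. *)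
Definition gram p : 'M[R]_m := 1%:M + p^T *m p.

Lemma gramN p : gram (- p) = gram p.
Proof. by rewrite /gram [(- p)^T]linearN /= mulNmx mulmxN opprK. Qed.

Lemma mul_outer p : p^T *m p *m (p^T *m p) = dot p p *: (p^T *m p).
Proof.
rewrite mulmxA -(mulmxA p^T) [p *m p^T]mx11_scalar -dotE.
by rewrite mul_mx_scalar -scalemxAl.
Qed.

(** The Sherman-Morrison formula. *)
Lemma invmx_gram p : invmx (gram p) = 1%:M - (1 + dot p p)^-1 *: (p^T *m p).
Proof.
have q0 : 1 + dot p p != 0 by rewrite gt_eqF // ltr_wpDr ?dot_ge0.
set H := (X in _ = X).
suff GH : gram p *m H = 1%:M.
  by rewrite -[LHS]mulmx1 -GH mulKmx //; case: (mulmx1_unit GH).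
rewrite mulmxBr mulmx1 /gram mulmxDl mul1mx -scalemxAr mul_outer scalerA.
rewrite -[p^T *m p in X in X - _]scale1r -addrA -scalerDl -scalerBl.
rewrite (_ : 1 - _ = 0) ?scale0r ?addr0 //.
by rewrite -[X in _ - (X + _)]mulr1 -mulrDr mulVf ?subrr.
Qed.

(** On the orthogonal of [p] the inverse is the identity, and on the line of
    [p] it is multiplication by [1 / W^2] with [W^2 = 1 + |p|^2].  A square root
    acts there as [1 / W], that is, it is [1 - c * p^T p] with
    [c = (1 - 1 / W) / |p|^2]; the form [1 / (W * (W + 1))] of this constant
    makes sense for [p = 0] too. *)
Lemma invmx_gram_sqrt p : exists2 B, B^T = B & B *m B = invmx (gram p).
Proof.
pose W := Num.sqrt (1 + dot p p).
have W2 : W ^+ 2 = 1 + dot p p by rewrite sqr_sqrtr // addr_ge0 ?dot_ge0.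
have W0 : 0 < W by rewrite sqrtr_gt0 ltr_wpDr ?dot_ge0.
exists (1%:M - (W * (W + 1))^-1 *: (p^T *m p)).
  by rewrite linearB linearZ /= trmx1 trmx_mul trmxK.
rewrite mulmxBr mulmx1 mulmxBl mul1mx -scalemxAr -scalemxAl mul_outer.
rewrite invmx_gram -W2.
have -> : dot p p = W ^+ 2 - 1 by rewrite W2 addrAC subrr add0r.
have W1 : W + 1 != 0 by rewrite gt_eqF // addr_gt0.
apply/matrixP => i j; move: (p^T *m p) => M; rewrite !mxE.
by field; rewrite W1 gt_eqF.
Qed.

Lemma mxtrace_invmx_gram_le p : \tr (invmx (gram p)) <= m%:R.
Proof.
rewrite invmx_gram linearB linearZ /= mxtrace1 mxtrace_mulC /mxtrace big_ord1 -dotE.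
by rewrite gerBl mulr_ge0 ?invr_ge0 ?addr_ge0 ?dot_ge0.
Qed.

(** A symmetric square root [B] writes the left-hand side as the sum, over the
    rows [b] of [B], of the quadratic form of [A] at [b]; the squared norms of
    these rows add up to the trace of the inverse metric, which is at most
    [m]. *)
Lemma trace_elliptic_le p A (K : R) : 0 <= K ->
  (forall b, \sum_(i < m) \sum_(j < m) b 0 i * b 0 j * A i j <= K * dot b b) ->
  \sum_(i < m) \sum_(j < m) invmx (gram p) i j * A i j <= K * m%:R.
Proof.
move=> K0 leA; have [B BT BB] := invmx_gram_sqrt p.
apply: le_trans (ler_wpM2l K0 (mxtrace_invmx_gram_le p)).
have entry i j : invmx (gram p) i j = \sum_(k < m) B k i * B k j.
  by rewrite -BB mxE; apply: eq_bigr => k _; rewrite -{1}BT mxE.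
have -> : \sum_(i < m) \sum_(j < m) invmx (gram p) i j * A i j =
    \sum_(k < m) \sum_(i < m) \sum_(j < m) row k B 0 i * row k B 0 j * A i j.
  rewrite [RHS]exchange_big; apply: eq_bigr => i _.
  rewrite [RHS]exchange_big; apply: eq_bigr => j _.
  by rewrite entry mulr_suml; apply: eq_bigr => k _; rewrite !mxE.
have -> : \tr (invmx (gram p)) = \sum_(k < m) dot (row k B) (row k B).
  rewrite exchange_big; apply: eq_bigr => i _.
  by rewrite entry; apply: eq_bigr => k _; rewrite !mxE.
by rewrite mulr_sumr; apply: ler_sum => k _; exact: leA.
Qed.

End Elliptic.

(** * The translator equation of a graph *)

Lemma is_derive_row_mx (R : realType) (V : normedModType R) (m : nat)
    (f : V -> R) (w : V -> 'rV[R]_m) (x e : V) (df : R) (dw : 'rV[R]_m) :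
  is_derive x e f df -> (forall j, is_derive x e (fun y => w y 0 j) (dw 0 j)) ->
  is_derive x e (fun y => row_mx (f y)%:M (w y) : 'rV[R]_(1 + m))
    (row_mx df%:M dw).
Proof.
move=> [fe fE] we.
have entry i (j : 'I_(1 + m)) : is_derive x e
    (fun y => row_mx (f y)%:M (w y) i j) ((row_mx df%:M dw : 'rV_(1 + m)) i j).
  rewrite ord1; case: (splitP j) => k jk.
    have -> : j = lshift m k by exact: val_inj.
    have -> : (fun y => row_mx (f y)%:M (w y) 0 (lshift m k)) = f.
      by apply/funext => y; rewrite row_mxEl mxE ord1 mulr1n.
    by rewrite row_mxEl mxE ord1 mulr1n; exact: DeriveDef.
  have -> : j = rshift 1 k by exact: val_inj.
  have -> : (fun y => row_mx (f y)%:M (w y) 0 (rshift 1 k)) = fun y => w y 0 k.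
    by apply/funext => y; rewrite row_mxEr.
  by rewrite row_mxEr; exact: we.
have d : derivable (fun y => row_mx (f y)%:M (w y) : 'rV[R]_(1 + m)) x e.
  by apply/derivable_mxP => i j; case: (entry i j).
apply: DeriveDef => //; rewrite derive_mx //.
by apply/matrixP => i j; rewrite mxE; case: (entry i j).
Qed.

Lemma is_derive_coord (R : realType) (m : nat) (x e : 'rV[R]_m) j :
  is_derive x e (fun y : 'rV[R]_m => y 0 j) (e 0 j).
Proof.
have id_e : derivable (@id 'rV[R]_m) x e by exact: derivable_id.
have := derive_id x e; rewrite derive_mx // => /matrixP /(_ 0 j); rewrite mxE => dE.
by apply: DeriveDef => //; exact: (derivable_mxP _ _ _).1 id_e 0 j.
Qed.

Section GraphGeometry.
Context {R : realType} {m : nat}.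
Context (v : 'rV[R]_m -> R) (hv : Ck 2 v).

Definition grad (x : 'rV[R]_m) : 'rV[R]_m := \row_i partial i v x.

Lemma Ck2_is_derive i x : is_derive x (delta_mx 0 i) v (grad x 0 i).
Proof. by rewrite mxE; apply: DeriveDef => //; case: hv => _ /(_ i)[]. Qed.

Lemma Ck2_grad_is_derive i j x : is_derive x (delta_mx 0 j)
  (fun y => grad y 0 i) (partial j (partial i v) x).
Proof.
under eq_fun do rewrite mxE.
by apply: DeriveDef => //; case: hv => _ /(_ i)[_ [_ /(_ j)[]]].
Qed.

Lemma Ck2_grad_continuous i : continuous (fun y => grad y 0 i).
Proof.
under eq_fun do rewrite mxE.
by case: hv => _ /(_ i)[_ []].
Qed.

Lemma Ck2_hess_continuous i j : continuous (partial j (partial i v)).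
Proof. by case: hv => _ /(_ i)[_ [_ /(_ j)[_ []]]]. Qed.

Lemma partial_graph i x :
  partial i (graph_param v) x = row_mx (grad x 0 i)%:M (delta_mx 0 i).
Proof.
have [_ <-] // : is_derive x (delta_mx 0 i) (graph_param v)
  (row_mx (grad x 0 i)%:M (delta_mx 0 i)).
apply: is_derive_row_mx => [|j]; first exact: Ck2_is_derive.
exact: is_derive_coord.
Qed.

Lemma partial2_graph i j x : partial i (partial j (graph_param v)) x =
  row_mx (partial i (partial j v) x)%:M 0.
Proof.
have -> : partial j (graph_param v) =
    fun y => row_mx (grad y 0 j)%:M (delta_mx 0 j).
  by apply/funext => y; exact: partial_graph.
have [_ <-] // : is_derive x (delta_mx 0 i)
  (fun y => row_mx (grad y 0 j)%:M (delta_mx 0 j) : 'rV[R]_(1 + m))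
  (row_mx (partial i (partial j v) x)%:M 0).
apply: (@is_derive_row_mx _ _ _ _ (fun=> delta_mx 0 j)) => [|k].
  exact: Ck2_grad_is_derive.
by rewrite [X in is_derive _ _ _ X]mxE; exact: is_derive_cst.
Qed.

Lemma metric_graph x : metric (graph_param v) x = gram (grad x).
Proof.
apply/matrixP => i j; rewrite !mxE !partial_graph dot_row_mx dot_scalar dot_delta.
by rewrite big_ord1 !mxE eqxx addrC eq_sym.
Qed.

Definition graph_normal x : 'rV[R]_(1 + m) := row_mx 1%:M (- grad x).

(** The normal direction only sees the normal part: each [partial j F] is
    orthogonal to it, so the tangent part drops out. *)
Lemma dot_normal_part x (u : 'rV[R]_(1 + m)) :
  dot (graph_normal x) (normal_part (graph_param v) x u) = dot (graph_normal x) u.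
Proof.
rewrite linearB /= [X in _ - X]linear_sum /= big1 ?subr0 // => i _.
rewrite linear_sum big1 // => j _; rewrite linearZ /= (partial_graph j).
rewrite /graph_normal dot_row_mx dot_scalar mul1r dot_delta !mxE.
by rewrite subrr mulr0.
Qed.

(** Second derivatives of the parametrization are vertical, so their normal
    component is just [v_ij] when measured against [(1, - p)]. *)
Lemma translator_equation (Y : 'rV[R]_(1 + m)) x :
  self_translator (graph_param v) Y ->
  \sum_(i < m) \sum_(j < m)
    invmx (gram (grad x)) i j * partial i (partial j v) x =
  s_coord Y - dot (grad x) (rsubmx Y).
Proof.
move=> /(_ x) /(congr1 (dot (graph_normal x))).
rewrite dot_normal_part linear_sum /= => E.
transitivity (dot (graph_normal x) Y).
  rewrite -E; apply: eq_bigr => i _; rewrite linear_sum; apply: eq_bigr => j _.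
  rewrite linearZ /= dot_normal_part partial2_graph /graph_normal.
  rewrite dot_row_mx dot_scalar mul1r.
  by rewrite linear0 addr0 /inv_metric metric_graph.
rewrite /graph_normal -[Y in LHS]hsubmxK [lsubmx Y]mx11_scalar.
rewrite dot_row_mx dot_scalar mul1r.
by rewrite ![dot _ (rsubmx Y)]dotC linearN.
Qed.

End GraphGeometry.

(** * Nonexistence *)

(** At the touching point the left-hand side of the equation is at most
    [2 k m], and the right-hand side is at least [y0 - a * |y|], a positive
    number fixed before [k] is made small.  The derivatives enter as functions
    [p] and [A] so that the result applies to both [v] and [- v]. *)
Lemma no_solution_of_small_slope (R : realType) (m : nat)
    (v : 'rV[R]_m -> R) (p : 'rV[R]_m -> 'rV[R]_m) (A : 'rV[R]_m -> 'M[R]_m)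
    (y0 a b M : R) (y : 'rV[R]_m) :
  continuous v ->
  (forall i x, is_derive x (delta_mx 0 i) v (p x 0 i)) ->
  (forall i j x, is_derive x (delta_mx 0 j) (fun y => p y 0 i) (A x j i)) ->
  (forall i, continuous (fun y => p y 0 i)) ->
  (forall i j, continuous (fun y => A y i j)) ->
  0 < a -> b < a -> a * enorm y < y0 ->
  (forall x, M < enorm x -> v x <= b * enorm x) ->
  ~ (forall x, \sum_(i < m) \sum_(j < m) invmx (gram (p x)) i j * A x i j =
     y0 - dot (p x) y).
Proof.
move=> vc dv dp pc Ac a0 ba ay vb eqn.
(* The successor of [m] makes [eps * m] strictly smaller than [y0 - a * |y|]. *)
pose eps := (y0 - a * enorm y) / (m.+1)%:R.
have eps0 : 0 < eps by rewrite divr_gt0 ?subr_gt0 ?ltr0Sn.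
have [x0 [k [k0 keps kx0 vle]]] :=
  paraboloid_touching _ _ _ _ _ _ _ vc a0 ba eps0 vb.
have [px0 Ax0] := paraboloid_touching_conditions _ _ _ _ _ _ _ dv dp pc Ac vle.
have k20 : 0 <= 2 * k by rewrite mulr_ge0.
have := trace_elliptic_le (p x0) _ _ k20 Ax0; rewrite eqn px0 leNgt => /negP; apply.
have py : dot ((2 * k) *: x0) y <= a * enorm y.
  rewrite dotC linearZ /= dotC (le_trans (ler_wpM2l k20 (dot_le_enorm _ _ _))) //.
  by rewrite mulrA ler_wpM2r ?enorm_ge0.
apply: (@lt_le_trans _ _ (y0 - a * enorm y)); last by rewrite lerD2l lerN2.
apply: (@le_lt_trans _ _ (eps * m%:R)); first by rewrite ler_wpM2r.
by rewrite -[ltRHS](divfK (_ : m.+1%:R != 0)) ?pnatr_eq0 // ltr_pM2l // ltr_nat.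
Qed.

(** The radius is taken positive because the quotient by [enorm x] carries no
    information at the origin. *)
Lemma limsup_slope_bound (R : realType) (m : nat) (v : 'rV[R]_m -> R)
    (vhat b : R) :
  limf_esup (fun x : 'rV[R]_m => (`|v x| / enorm x)%:E) enorm_infty = vhat%:E ->
  vhat < b -> exists M, forall x, M < enorm x -> `|v x| <= b * enorm x.
Proof.
rewrite -lte_fin => <- /ereal_inf_lt [_ /= [S [M _ MS] <-]] supS.
exists (Num.max M 0) => x; rewrite gt_max => /andP[Mx x0].
rewrite -ler_pdivrMr // -lee_fin (le_trans _ (ltW supS)) //.
by apply: ereal_sup_ubound; exists x => //; exact: MS.
Qed.

(** In this form the angle condition reads [vhat * |y| < |s|], with no exception
    for vertical vectors, where [y = 0]. *)
Lemma no_translator_graph (R : realType) (m : nat) (v : 'rV[R]_m -> R)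
    (hv : Ck 2 v) (vhat : R) (Y : 'rV[R]_(1 + m)) :
  limf_esup (fun x : 'rV[R]_m => (`|v x| / enorm x)%:E) enorm_infty
    = vhat%:E ->
  s_coord Y != 0 -> vhat * enorm (rsubmx Y) < `|s_coord Y| ->
  ~ self_translator (graph_param v) Y.
Proof.
move=> hvhat Y0 slope tr.
have [b [a [vb ba a0 aY]]] : exists b a,
    [/\ vhat < b, b < a, 0 < a & a * enorm (rsubmx Y) < `|s_coord Y|].
  have := enorm_ge0 _ (rsubmx Y); set n := enorm _ in slope * => n0.
  (* Slopes [b < a] slightly above [max vhat 0]: the excess [d] is small enough
     for [(c + d) * n] to stay below [|s_coord Y|], also when [n = 0]. *)
  pose c := Num.max vhat 0.
  have cn : c * n < `|s_coord Y|.
    by rewrite /c; case: (leP vhat 0) => // _; rewrite mul0r normr_gt0.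
  pose d := (`|s_coord Y| - c * n) / (n + 1).
  have n1 : 0 < n + 1 by rewrite ltr_wpDl.
  have d0 : 0 < d by rewrite divr_gt0 // subr_gt0.
  have dn : d * n < `|s_coord Y| - c * n.
    by rewrite mulrAC ltr_pdivrMr // ltr_pM2l ?subr_gt0 // ltrDl.
  have cv : vhat <= c by rewrite le_max lexx.
  have c0 : 0 <= c by rewrite le_max lexx orbT.
  by exists (c + d / 2), (c + d); split; lra.
have [M vM] := limsup_slope_bound _ _ _ _ _ hvhat vb.
have vc : continuous v by case: hv.
have eqn x := translator_equation _ hv Y x tr.
have [Ypos|Yneg] := leP 0 (s_coord Y).
  move: aY; rewrite ger0_norm // => aY.
  apply: (@no_solution_of_small_slope _ _ v (grad v)
    (fun x => \matrix_(i, j) partial i (partial j v) x) (s_coord Y) a b M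
    (rsubmx Y)) => //.
  - exact: Ck2_is_derive.
  - by move=> i j x; rewrite mxE; exact: Ck2_grad_is_derive.
  - exact: Ck2_grad_continuous.
  - by move=> i j; under eq_fun do rewrite mxE; exact: Ck2_hess_continuous.
  - by move=> x Mx; rewrite (le_trans (ler_norm _)) // vM.
  - move=> x; rewrite -eqn; apply: eq_bigr => i _; apply: eq_bigr => j _.
    by rewrite mxE.
move: aY; rewrite ltr0_norm // => aY.
apply: (@no_solution_of_small_slope _ _ (fun x => - v x) (fun x => - grad v x)
  (fun x => - \matrix_(i, j) partial i (partial j v) x) (- s_coord Y) a b M
  (rsubmx Y)) => //.
- by move=> x; apply: continuousN; exact: vc.
- by move=> i x; rewrite mxE; apply: is_deriveN; exact: Ck2_is_derive.
- move=> i j x; rewrite !mxE; under eq_fun do rewrite mxE.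
  by apply: is_deriveN; exact: Ck2_grad_is_derive.
- move=> i x; under eq_fun do rewrite mxE.
  by apply: continuousN; exact: Ck2_grad_continuous.
- move=> i j x; under eq_fun do rewrite !mxE.
  by apply: continuousN; exact: Ck2_hess_continuous.
- by move=> x Mx; rewrite (le_trans (ler_norm _)) // normrN vM.
move=> x; rewrite gramN dotC linearN /= dotC opprK addrC -opprB -eqn -sumrN.
apply: eq_bigr => i _.
by rewrite -sumrN; apply: eq_bigr => j _; rewrite !mxE mulrN.
Qed.

Theorem theorem5p20 (R : realType) (m : nat) (hm : (2 <= m)%N)
    (v : 'rV[R]_m -> R) (hv : Ck 2 v) (vhat : R)
    (hvhat : limf_esup (fun x : 'rV[R]_m => (`|v x| / enorm x)%:E) enorm_infty
             = vhat%:E) :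
  (forall Y : 'rV[R]_(1 + m), Y != 0 ->
     0 < angle_horizontal Y < pi / 2 ->
     vhat < tan (angle_horizontal Y) ->
     ~ self_translator (graph_param v) Y) /\
  (vhat = 0 ->
   forall Y : 'rV[R]_(1 + m), ~ horizontal Y ->
     ~ self_translator (graph_param v) Y).
Proof.
split=> [Y Y0 /andP[th0 th_lt]|vhat0 Y /eqP Y0]; last first.
  by apply: (no_translator_graph _ _ _ hv _ _ hvhat) => //;
    rewrite vhat0 mul0r normr_gt0.
have Y2 : enorm Y ^+ 2 = s_coord Y ^+ 2 + enorm (rsubmx Y) ^+ 2.
  rewrite !sqr_enorm -{1 2}[Y]hsubmxK dot_row_mx [lsubmx Y]mx11_scalar dot_scalar.
  by rewrite expr2.
have nY : 0 < enorm Y.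
  rewrite lt_def enorm_ge0 andbT; apply: contra_neq Y0 => n0.
  apply/rowP => i; apply/eqP; rewrite mxE -normr_le0 -n0.
  exact: le_coord_enorm.
have ratio : -1 <= `|s_coord Y| / enorm Y <= 1.
  rewrite (le_trans (lerN10 _)) ?divr_ge0 ?enorm_ge0 //=.
  rewrite ler_pdivrMr // mul1r -ler_sqr ?nnegrE ?enorm_ge0 //.
  by rewrite real_normK ?num_real // Y2 lerDl sqr_ge0.
have sinE : sin (angle_horizontal Y) = `|s_coord Y| / enorm Y.
  by rewrite asinK // in_itv.
have sY : s_coord Y != 0.
  have : 0 < sin (angle_horizontal Y).
    by apply: sin_gt0_pihalf; rewrite th0.
  by apply: contraTneq => s0; rewrite sinE s0 normr0 mul0r ltxx.
have cosE : cos (angle_horizontal Y) = enorm (rsubmx Y) / enorm Y.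
  rewrite cos_asin // (_ : 1 - _ = (enorm (rsubmx Y) / enorm Y) ^+ 2).
    by rewrite sqrtr_sqr ger0_norm // divr_ge0 ?enorm_ge0.
  rewrite !expr_div_n real_normK ?num_real //.
  have -> : enorm (rsubmx Y) ^+ 2 = enorm Y ^+ 2 - s_coord Y ^+ 2.
    by rewrite Y2 addrC addKr.
  by field; rewrite gt_eqF.
have cos_pos : 0 < cos (angle_horizontal Y).
  apply: cos_gt0_pihalf; rewrite th_lt andbT (lt_trans _ th0) //.
  by rewrite oppr_lt0 divr_gt0 ?pi_gt0.
rewrite /tan ltr_pdivlMr // sinE cosE mulrA ltr_pM2r ?invr_gt0 //.
exact: no_translator_graph hvhat sY.
Qed.
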